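(* If $G$ is a connected finite bipartite graph that has a perfect matching, then $G^3_B$ is Hamilton-laceable: for any two vertices $x,y$ lying in distinct bipartition sets of $G$, $G^3_B$ has a Hamiltonian $(x,y)$-path (a path from $x$ to $y$ containing all vertices).
   Context: For a graph $G$ and integer $t\ge1$, $G^t_B$ is the graph on $V(G)$ in which $x,y$ are adjacent iff $d_G(x,y)$ is odd and at most $t$. *)

(* Defs.v *)
From mathcomp Require Import all_boot.
Set Implicit Arguments.
Unset Strict Implicit.
Unset Printing Implicit Defensive.

(* A finite simple graph is a symmetric irreflexive relation on a finType. *)

Section Graphs.
Variables (T : finType) (e : rel T).

Definition simple_graph : Prop := symmetric e /\ irreflexive e.

Definition connected_graph : Prop := forall x y : T, connect e x y.

Definition bipartition (A B : {set T}) : Prop :=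
  [/\ A :|: B = [set: T], [disjoint A & B]
    & forall x y : T, e x y -> (x \in A) && (y \in B) || (x \in B) && (y \in A)].

Definition bipartite : Prop := exists A B : {set T}, bipartition A B.

Definition edges : {set {set T}} :=
  [set [set u.1; u.2] | u : T * T & e u.1 u.2].

Definition perfect_matching (M : {set {set T}}) : Prop :=
  [/\ M \subset edges, trivIset M & cover M = [set: T]].

Definition walkn (n : nat) (x y : T) : bool :=
  [exists p : n.-tuple T, path e x p && (last x p == y)].

(* A shortest walk has fewer than #|T| edges, so the search range suffices;
   gdist x y is the junk value #|T| when x and y are not connected. *)
Definition gdist (x y : T) : nat :=
  find (fun n => walkn n x y) (iota 0 #|T|).

(* The connect conjunct discards the junk value of gdist. *)
Definition bip_power (t : nat) : rel T :=
  fun x y => [&& connect e x y, odd (gdist x y) & gdist x y <= t].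

End Graphs.

Definition hamiltonian_path (T : finType) (g : rel T) (x y : T) (p : seq T) : Prop :=
  [/\ path g x p, last x p = y, uniq (x :: p) & forall z : T, z \in x :: p].

(* The bipartition sets are those of e, the paths are in g. *)
Definition hamilton_laceable (T : finType) (e g : rel T) : Prop :=
  forall A B : {set T}, bipartition e A B ->
  forall x y : T, x \in A -> y \in B ->
  exists p : seq T, hamiltonian_path g x y p.

(* Main.v *)
Require Import Defs.
From mathcomp Require Import all_boot.

(** Induct on the sets [S] of vertices which are closed under the matching and
    induce a connected subgraph. Given a matching edge [x x'] in [S], let [C] be
    a component of [S] minus [x], [x']: then [C] and [S] minus [C] are again such
    sets, and some edge joins [C] to [x] or to [x'].
    - If [y] is not [x'], choose [C] to contain [y]. A path from [x] to [x'] in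
      the complement of [C] is followed by a path from some [a] to [y] in [C],
      where [a] is at distance at most 3 from [x'].
    - If [y = x'], a path of [C] between the ends of a matching edge next to
      [x] or [x'] is inserted into a path from [x] to [x'] in the complement of
      [C], just before [x'] or just after [x] respectively. To make this possible
      the induction also records where the second and the last but one vertices
      lie. *)

Set Implicit Arguments.
Unset Strict Implicit.
Unset Printing Implicit Defensive.

(** * Induced subgraphs and their components *)

Section Induced.
Variables (T : finType) (e : rel T).
Hypothesis e_sym : symmetric e.

Definition induced (S : {set T}) : rel T :=
  fun u v => [&& u \in S, v \in S & e u v].

Definition connected_in (S : {set T}) : Prop :=
  {in S &, forall x y, connect (induced S) x y}.

Lemma connect_induced_sym (S : {set T}) : connect_sym (induced S).
Proof. by apply: sym_connect_sym => u v; rewrite /induced e_sym andbCA. Qed.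

Lemma connect_invariant (r : rel T) (W : {set T}) (x y : T) :
  (forall u v, u \in W -> r u v -> v \in W) ->
  x \in W -> connect r x y -> y \in W.
Proof.
move=> Wr Wx /connectP[p]; elim: p x Wx => [|z p IHp] x Wx /=; first by move=> _ ->.
by case/andP=> rxz; apply: IHp; apply: Wr rxz.
Qed.

Lemma connected_in_from (S : {set T}) (x : T) :
  (forall z, z \in S -> connect (induced S) x z) -> connected_in S.
Proof.
move=> Sx y z Sy Sz; apply: connect_trans (Sx z Sz).
by rewrite connect_induced_sym Sx.
Qed.

Section Component.
Variables (S X : {set T}) (k : T).

Definition component : {set T} :=
  [set z | connect (induced (S :\: X)) k z].

Lemma component_id : k \in component.
Proof. by rewrite inE connect0. Qed.

Lemma component_step (u v : T) :
  u \in component -> u \in S :\: X -> v \in S :\: X -> e u v -> v \in component.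
Proof.
rewrite inE => ku uS vS euv; rewrite inE; apply: connect_trans ku (connect1 _).
by rewrite /induced uS vS.
Qed.

Hypothesis kS : k \in S :\: X.

Lemma component_sub : component \subset S :\: X.
Proof.
by apply/subsetP=> z; rewrite inE; apply: connect_invariant kS => u v _ /and3P[].
Qed.

Lemma component_connected : connected_in component.
Proof.
apply: (@connected_in_from _ k) => z; rewrite inE => kz.
suff: z \in [set w in component | connect (induced component) k w].
  by rewrite inE => /andP[].
apply: connect_invariant kz => [u v|]; last by rewrite inE component_id connect0.
rewrite inE => /andP[Cu ku] /and3P[uS vS euv].
have Cv := component_step Cu uS vS euv.
by rewrite inE Cv; apply: connect_trans ku (connect1 _); rewrite /induced Cu Cv.
Qed.

(** If no edge joined [X] to the component, the component would be closed under steps inside the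
    connected set [S], so it would contain [x], although it avoids [X]. *)
Lemma component_cross (x : T) : connected_in S -> x \in S -> x \in X ->
  exists u v, [/\ u \in X, v \in component & e u v].
Proof.
move=> Sc Sx Xx.
case: (boolP [exists u in X, exists v in component, e u v]).
  case/existsP=> u /andP[Xu /existsP[v /andP[Cv euv]]].
  by exists u, v.
move=> noedge; have [kX Sk] := setDP kS.
suff /(subsetP component_sub): x \in component by rewrite inE Xx.
apply: connect_invariant component_id (Sc k x _ Sx) => // u v Cu /and3P[Su Sv euv].
apply: (component_step Cu) (euv); first exact: (subsetP component_sub).
rewrite inE Sv andbT; apply: contra noedge => Xv.
by apply/existsP; exists v; rewrite Xv; apply/existsP; exists u; rewrite Cu e_sym.
Qed.

(** [X] is a star centred at [x], so it stays connected without the component. A step in [S] that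
    leaves the component must enter [X], so the component together with what [x] reaches outside it
    is closed under steps in [S], hence contains all of [S]. *)
Lemma component_compl_connected (x : T) :
  connected_in S -> X \subset S -> x \in X ->
  {in X, forall w, w = x \/ e x w} -> connected_in (S :\: component).
Proof.
move=> Sc XS Xx Xstar; set D := S :\: component.
have XD w : w \in X -> w \in D.
  move=> Xw; rewrite inE (subsetP XS) // andbT.
  by apply: contraL Xw => /(subsetP component_sub)/setDP[].
have connX w : w \in X -> connect (induced D) x w.
  move=> Xw; case: (Xstar w Xw) => [->|exw]; first exact: connect0.
  by apply: connect1; rewrite /induced !XD.
apply: (@connected_in_from _ x) => z /setDP[Sz nCz].
suff: z \in component :|: [set w in D | connect (induced D) x w].
  by rewrite in_setU (negPf nCz) in_set => /andP[].
apply: connect_invariant (Sc x z (subsetP XS _ Xx) Sz) => [u v W_u /and3P[Su Sv euv]|];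
  last by rewrite in_setU in_set XD // connect0 orbT.
rewrite in_setU in_set.
case: (boolP (v \in component)) => //= nCv; rewrite [v \in D]inE nCv Sv /=.
case: (boolP (v \in X)) => [/connX//|nXv].
move: W_u; rewrite in_setU in_set => /orP[Cu|/andP[Du xu]].
  case/negP: nCv; apply: (component_step Cu) (euv); first exact: (subsetP component_sub).
  by rewrite inE nXv.
by apply: connect_trans xu (connect1 _); rewrite /induced Du [v \in D]inE nCv Sv.
Qed.

End Component.
End Induced.

(** * Odd distances in a connected bipartite graph *)

Section BipartitePower.
Variables (T : finType) (e : rel T) (A : {set T}).
Hypothesis e_conn : connected_graph e.
Hypothesis e_bip : forall x y, e x y -> (y \in A) = (x \notin A).

Lemma path_side (x : T) (p : seq T) :
  path e x p -> (last x p \in A) = (x \in A) (+) odd (size p).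
Proof.
elim: p x => [|y p IHp] x /=; first by rewrite addbF.
by case/andP=> /e_bip xy /IHp ->; rewrite xy addNb addbN.
Qed.

Lemma walknP (n : nat) (x y : T) :
  reflect (exists p, [/\ path e x p, last x p = y & size p = n]) (walkn e n x y).
Proof.
apply: (iffP existsP) => [[p /andP[xp /eqP xy]]|[p [xp xy sz]]].
  by exists p; rewrite size_tuple.
have sz' : size p == n by rewrite sz.
by exists (Tuple sz') => /=; rewrite xp xy /=.
Qed.

(** A walk shortens to a duplicate-free path, which has fewer than [#|T|] edges, so the search in
    [gdist] succeeds and never returns its default value. *)
Lemma gdist_lt (x y : T) : gdist e x y < #|T|.
Proof.
rewrite /gdist -[X in _ < X](size_iota 0) -has_find.
have /connectP[p0 xp0 ->] := e_conn x y.
case/shortenP: xp0 => p xp up _.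
apply/hasP; exists (size p); last by apply/walknP; exists p.
by rewrite mem_iota /= add0n; have := max_card (mem (x :: p)); rewrite (card_uniqP up).
Qed.

Lemma walkn_gdist (x y : T) : walkn e (gdist e x y) x y.
Proof.
have lt := gdist_lt x y.
have := @nth_find _ 0 (fun n => walkn e n x y) (iota 0 #|T|).
by rewrite has_find size_iota -/(gdist e x y) nth_iota // => ->.
Qed.

Lemma gdist_min (n : nat) (x y : T) : walkn e n x y -> gdist e x y <= n.
Proof.
move=> w; rewrite leqNgt; apply/negP => lt_n.
have := before_find 0 lt_n.
by rewrite nth_iota ?w // (ltn_trans lt_n) ?gdist_lt.
Qed.

(** The ends of a walk fix the parity of its length, so the distance is odd too, and it is at most
    that length. Walks with repeated vertices can thus replace exact distances. *)
Lemma bip_power_walk (t : nat) (x : T) (p : seq T) :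
  path e x p -> odd (size p) -> size p <= t -> bip_power e t x (last x p).
Proof.
move=> xp op le_t; rewrite /bip_power e_conn /=.
have xyA := path_side xp.
have /walknP[q [xq xy sz]] := walkn_gdist x (last x p).
rewrite -sz; apply/andP; split.
  by move: xyA; rewrite -xy path_side // op => /addbI ->.
by rewrite sz (leq_trans _ le_t) // gdist_min //; apply/walknP; exists p.
Qed.

Lemma bip_power_edge (t : nat) (x y : T) : 0 < t -> e x y -> bip_power e t x y.
Proof. by move=> t_gt0 xy; apply: (@bip_power_walk t x [:: y]); rewrite //= xy. Qed.

Lemma bip_power_walk3 (x a b y : T) :
  e x a -> e a b -> e b y -> bip_power e 3 x y.
Proof. by move=> xa ab b_y; apply: (@bip_power_walk 3 x [:: a; b; y]); rewrite //= xa ab b_y. Qed.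

End BipartitePower.

(** Choose an edge of [M] through each vertex. Those chosen at [x] and at [mate x] share [mate x],
    so they coincide by disjointness. *)
Lemma perfect_matching_mate (T : finType) (e : rel T) (M : {set {set T}}) :
  simple_graph e -> perfect_matching e M ->
  exists mate : T -> T, involutive mate /\ forall x, e x (mate x).
Proof.
move=> [e_sym e_irr] [Me tI covM].
have ex x : exists y, e x y /\ [set x; y] \in M.
  have: x \in cover M by rewrite covM inE.
  case/bigcupP=> b Mb xb; have /imsetP[[u v] /= euv b_uv] := subsetP Me b Mb.
  rewrite inE /= in euv; subst b.
  case/set2P: xb => ->; first by exists v.
  by exists u; rewrite e_sym setUC.
have [mate mateP] := fin_all_exists ex.
exists mate; split=> x; last by case: (mateP x).
have [e1 M1] := mateP x; have [e2 M2] := mateP (mate x).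
have eqb : [set x; mate x] = [set mate x; mate (mate x)].
  by rewrite -(def_pblock tI M1 (set22 _ _)) (def_pblock tI M2 (set21 _ _)).
have: x \in [set mate x; mate (mate x)] by rewrite -eqb set21.
by case/set2P=> // xm; rewrite -xm e_irr in e1.
Qed.

(** * Spanning paths of connected sets closed under the matching *)

Section Laceable.
Variables (T : finType) (e g : rel T) (A : {set T}) (mate : T -> T).
Hypothesis e_sym : symmetric e.
Hypothesis e_bip : forall x y, e x y -> (y \in A) = (x \notin A).
Hypothesis mateK : involutive mate.
Hypothesis e_mate : forall x, e x (mate x).
Hypothesis g1 : forall x y, e x y -> g x y.
Hypothesis g3 : forall x a b y, e x a -> e a b -> e b y -> g x y.

Definition mate_closed (S : {set T}) : Prop := forall z, z \in S -> mate z \in S.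

Lemma mate_side (x : T) : (mate x \in A) = (x \notin A).
Proof. exact: e_bip. Qed.

Definition spanning_path (S : {set T}) (x y : T) (q : seq T) : Prop :=
  [/\ path g x (rcons q y), uniq (x :: rcons q y) & x :: rcons q y =i S].

(* The last two clauses are what lets a path be inserted next to [x] or [y]. *)
Definition extensible_path (S : {set T}) (x y : T) (q : seq T) : Prop :=
  [/\ spanning_path S x y q,
      e x (head y q) \/ e (mate (head y q)) y
    & e (last x q) y \/ e x (mate (last x q))].

(** Splicing only rearranges the vertices of two disjoint paths, so this settles distinctness and
    coverage for all three ways of joining them. *)
Lemma uniq_perm_set (S1 S2 : {set T}) (s s1 s2 : seq T) :
  uniq s1 -> uniq s2 -> s1 =i S1 -> s2 =i S2 -> [disjoint S1 & S2] ->
  perm_eq s (s1 ++ s2) -> uniq s /\ s =i S1 :|: S2.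
Proof.
move=> u1 u2 E1 E2 dis Ps; split; last first.
  by move=> z; rewrite (perm_mem Ps) mem_cat E1 E2 in_setU.
rewrite (perm_uniq Ps) cat_uniq u1 u2 andbT /=.
apply/hasPn => z; rewrite E2 => S2z; rewrite /= E1.
by rewrite (disjointFl dis).
Qed.

Lemma spanning_path_cat (S1 S2 : {set T}) (x b a y : T) (q1 q2 : seq T) :
  spanning_path S1 x b q1 -> spanning_path S2 a y q2 -> [disjoint S1 & S2] ->
  g b a -> spanning_path (S1 :|: S2) x y (rcons q1 b ++ a :: q2).
Proof.
move=> [p1 u1 E1] [p2 u2 E2] dis gba.
have [] := @uniq_perm_set _ _ (x :: rcons (rcons q1 b ++ a :: q2) y) _ _ u1 u2 E1 E2 dis.
  by rewrite rcons_cat.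
by split=> //; rewrite rcons_cat cat_path p1 last_rcons /= gba.
Qed.

Lemma spanning_path_insert_head (S1 S2 : {set T}) (x y c d : T) (q1 q2 : seq T) :
  spanning_path S1 x y q1 -> spanning_path S2 d c q2 -> [disjoint S1 & S2] ->
  g x d -> g c (head y q1) ->
  spanning_path (S1 :|: S2) x y (d :: rcons q2 c ++ q1).
Proof.
move=> [p1 u1 E1] [p2 u2 E2] dis gxd gcv.
have [] := @uniq_perm_set _ _ (x :: rcons (d :: rcons q2 c ++ q1) y) _ _ u1 u2 E1 E2 dis.
  rewrite /= perm_cons rcons_cat -cat_cons; exact: permEl (perm_catC _ _).
split=> //; rewrite /= gxd rcons_cat cat_path p2 last_rcons /=.
by case: (q1) p1 gcv => [|v q] /= /andP[_ p1'] ->.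
Qed.

Lemma spanning_path_insert_last (S1 S2 : {set T}) (x y c d : T) (q1 q2 : seq T) :
  spanning_path S1 x y q1 -> spanning_path S2 d c q2 -> [disjoint S1 & S2] ->
  g (last x q1) d -> g c y ->
  spanning_path (S1 :|: S2) x y (q1 ++ d :: rcons q2 c).
Proof.
move=> [p1 u1 E1] [p2 u2 E2] dis gud gcy.
have [] := @uniq_perm_set _ _ (x :: rcons (q1 ++ d :: rcons q2 c) y) _ _ u1 u2 E1 E2 dis.
  by rewrite /= perm_cons rcons_cat cat_rcons perm_cat2l perm_rcons.
split=> //; rewrite rcons_cat cat_path /= gud rcons_path p2 last_rcons gcy.
by move: p1; rewrite rcons_path => /andP[-> _].
Qed.

(** Extensibility is demanded for mates only, since only paths between mates receive an
    insertion. *)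
Lemma spanning_path_exists (S : {set T}) (x y : T) :
  mate_closed S -> connected_in e S -> x \in S -> y \in S ->
  (y \in A) = (x \notin A) ->
  exists q, spanning_path S x y q /\ (y = mate x -> extensible_path S x y q).
Proof.
have [n] := ubnP #|S|; elim: n S x y => // n IHn S x y /ltnSE-leSn Sm Sc Sx Sy xyA.
have xNy : x != y by apply/eqP => xy; move: xyA; rewrite xy; case: (_ \in _).
set X := [set x; mate x].
have XS : X \subset S by apply/subsetP=> z /set2P[] ->; rewrite ?Sm.
have Xx : x \in X by rewrite set21.
have Xstar : {in X, forall w, w = x \/ e x w}.
  by move=> w /set2P[] ->; [left | right].
have Xm z : (mate z \in X) = (z \in X).
  by rewrite !inE (inv_eq mateK) (inj_eq (inv_inj mateK)) orbC.
(* Both parts are smaller instances: [C] is closed under [mate] because [X] is, and neither part is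
   empty, as [k] lies in [C] and [x] outside it. *)
have split_at k : k \in S :\: X -> let C := component e S X k in
    [/\ [/\ mate_closed C, connected_in e C & #|C| < n],
        [/\ mate_closed (S :\: C), connected_in e (S :\: C) & #|S :\: C| < n],
        S :\: C :|: C = S, [disjoint S :\: C & C] & k \in C /\ X \subset S :\: C].
  move=> kSX C.
  have CSX : C \subset S :\: X := component_sub e kSX.
  have CS : C \subset S := subset_trans CSX (subsetDl _ _).
  have Cm : mate_closed C.
    move=> z Cz; have zSX := subsetP CSX z Cz.
    apply: (component_step Cz zSX) (e_mate z).
    by move: zSX; rewrite !in_setD Xm => /andP[-> /Sm].
  have Ck : k \in C := component_id _ _ _ _.
  have XD : X \subset S :\: C.
    by rewrite subsetD XS disjoint_sym; move: CSX; rewrite subsetD => /andP[].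
  have cC : #|C| < #|S|.
    apply: proper_card; apply/properP; split=> //; exists x => //.
    by move/(subsetP XD): Xx; rewrite inE => /andP[].
  have cD : #|S :\: C| < #|S|.
    apply: proper_card; apply/properP; split; first exact: subsetDl.
    by exists k; [exact: (subsetP CS) | rewrite inE Ck].
  split=> //.
  - split; [done | exact: component_connected | exact: leq_trans leSn].
  - split; last exact: leq_trans leSn; last exact: component_compl_connected Xstar.
    move=> z; rewrite !in_setD => /andP[nCz /Sm ->]; rewrite andbT.
    by apply: contra nCz => /Cm; rewrite mateK.
  - by rewrite setUC -{1}(setIidPr CS) setID.
  - by rewrite -setI_eq0 setDE -setIA [_ :&: C]setIC setICr setI0.
have [y_x'|y_x'] := eqVneq y (mate x).
  have [SX0|[k kSX]] := set_0Vmem (S :\: X).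
    have eS : S = X by apply/eqP; rewrite eqEsubset XS andbT -setD_eq0 SX0.
    have exy : e x y by rewrite y_x'.
    suff sp : spanning_path S x y [::] by exists [::]; split=> //; split=> //; left.
    split=> /=; first by rewrite g1.
      by rewrite inE xNy.
    by move=> z; rewrite eS y_x' !inE.
  case: (split_at k kSX); set C := component e S X k.
  move=> [Cm Cc cC] [Dm Dc cD] DC dis [Ck XD].
  have exy : e x y by rewrite y_x'.
  have eyx : e y x by rewrite e_sym.
  have [q1 [_ /(_ y_x')[sp1 hd1 la1]]] : exists q, spanning_path (S :\: C) x y q /\
      (y = mate x -> extensible_path (S :\: C) x y q).
    by apply: IHn; rewrite // (subsetP XD) // y_x' set22.
  have [u [v [Xu Cv euv]]] := component_cross e_sym kSX Sc Sx Xx.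
  (* The end of the edge [x y] at which the crossing edge starts decides where to insert: before [y]
     if it is [x], after [x] if it is [y]. *)
  case/set2P: Xu euv => [->|->] euv; last rewrite -y_x' in euv.
    pose c := mate v; have edc : e v c := e_mate v.
    have [q2 [sp2 _]] : exists q, spanning_path C v c q /\
        (c = mate v -> extensible_path C v c q).
      by apply: IHn; rewrite ?mate_side //; apply: Cm.
    exists (q1 ++ v :: rcons q2 c).
    suff sp : spanning_path S x y (q1 ++ v :: rcons q2 c).
      (* If [q1] is empty the head is [v], a neighbour of [x]; otherwise it is unchanged. The last
         interior vertex is [c], whose mate [v] is a neighbour of [x]. *)
      split=> // _; split=> //.
        by case: (q1) hd1 => //= _; left.
      by right; rewrite last_cat /= last_rcons mateK.
    (* From [last x q1], the vertex [v] is reached through [y] and [x], or through the mate of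
       [last x q1] and [x]; from [c], [y] is reached through [v] and [x]. *)
    rewrite -DC; apply: spanning_path_insert_last => //.
      case: la1 => [uy|xu]; first exact: g3 uy eyx euv.
      by apply: g3 (e_mate _) _ euv; rewrite e_sym.
    by apply: g3 exy; rewrite e_sym; [exact: edc | exact: euv].
  (* Mirror case: the path of [C] now runs from [d] to [v], and [x] reaches [d] through [y] and
     [v]. *)
  pose d := mate v; have evd : e v d := e_mate v.
  have evy : e v y by rewrite e_sym.
  have [q2 [sp2 _]] : exists q, spanning_path C d v q /\
      (v = mate d -> extensible_path C d v q).
    by apply: IHn; rewrite ?mate_side ?negbK //; apply: Cm.
  exists (d :: rcons q2 v ++ q1).
  suff sp : spanning_path S x y (d :: rcons q2 v ++ q1).
    split=> // _; split=> //=; first by right; rewrite mateK.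
    by rewrite last_cat last_rcons; case: (q1) la1 => //= _; left.
  rewrite -DC; apply: spanning_path_insert_head => //; first exact: g3 exy euv evd.
  case: hd1 => [xw|wy]; first exact: g3 evy eyx xw.
  by apply: g3 evy _ _; rewrite e_sym; [exact: wy | exact: e_mate].
have ySX : y \in S :\: X by rewrite !inE Sy negb_or y_x' eq_sym xNy.
case: (split_at y ySX); set C := component e S X y.
move=> [Cm Cc cC] [Dm Dc cD] DC dis [Cy XD].
have [q1 [sp1 _]] : exists q, spanning_path (S :\: C) x (mate x) q /\
    (mate x = mate x -> extensible_path (S :\: C) x (mate x) q).
  by apply: IHn; rewrite ?mate_side // (subsetP XD) // set22.
(* [a] must lie on the side of [x], opposite to [mate x] and to [y]. For a crossing edge from [x] to
   [v] take [mate v], reached from [mate x] through [x] and [v]; for one from [mate x] to [v] take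
   [v] itself. *)
have [a [Ca aA ga]] : exists a, [/\ a \in C, (a \in A) = (x \in A) & g (mate x) a].
  have [u [v [Xu Cv euv]]] := component_cross e_sym ySX Sc Sx Xx.
  case/set2P: Xu euv => [->|->] euv.
    exists (mate v); split; [exact: Cm | by rewrite mate_side (e_bip euv) negbK |].
    by apply: g3 euv (e_mate v); rewrite e_sym.
  by exists v; split=> //; [rewrite (e_bip euv) mate_side negbK | exact: g1].
have [q2 [sp2 _]] : exists q, spanning_path C a y q /\
    (y = mate a -> extensible_path C a y q).
  by apply: IHn; rewrite // aA.
exists (rcons q1 (mate x) ++ a :: q2); split; last by move/eqP; rewrite (negPf y_x').
by rewrite -DC; apply: spanning_path_cat sp1 sp2 dis ga.
Qed.

End Laceable.

Theorem theorem2p2 (T : finType) (e : rel T)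
  (e_simple : simple_graph e)
  (e_connected : connected_graph e)
  (e_bipartite : bipartite e)
  (e_matching : exists M : {set {set T}}, perfect_matching e M) :
  hamilton_laceable e (bip_power e 3).
Proof.
move=> A B [AB disAB eAB] x y Ax By; clear e_bipartite.
have [M /(perfect_matching_mate e_simple)[mate [mateK e_mate]]] := e_matching.
have inB z : (z \in B) = (z \notin A).
  have: z \in A :|: B by rewrite AB inE.
  rewrite inE; case: (boolP (z \in A)) => [Az _|_ //].
  by rewrite (disjointFr disAB).
have e_bip u v : e u v -> (v \in A) = (u \notin A).
  by move/eAB; rewrite !inB; case: (u \in A); case: (v \in A).
have [q [[xq uq qT] _]] : exists q, spanning_path (bip_power e 3) [set: T] x y q /\
    (y = mate x -> extensible_path e (bip_power e 3) mate [set: T] x y q).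
  (* On the whole vertex set the induced subgraph is the graph itself. *)
  apply: (@spanning_path_exists _ _ _ A) => //.
  - by case: e_simple.
  - by move=> u v; apply: (bip_power_edge e_connected e_bip).
  - by move=> u a b v; apply: (bip_power_walk3 e_connected e_bip).
  - move=> u v _ _; apply: connect_sub (e_connected u v) => a b ab.
    by apply: connect1; rewrite /induced !inE.
  - by move: By; rewrite inB Ax => /negPf.
exists (rcons q y); split=> //; first by rewrite last_rcons.
by move=> z; rewrite qT inE.
Qed.
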